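(* Let $\boldsymbol{x}_0\in\Delta(n)$, $\epsilon_x>0$, and $\mathcal{X}=\{\boldsymbol{x}\in\Delta(n):\|\boldsymbol{x}-\boldsymbol{x}_0\|_2\le\epsilon_x\}$. Assume that $$\{\boldsymbol{x}\in\mathbb{R}^n:\boldsymbol{x}^\top\boldsymbol{e}=1\}\cap\{\boldsymbol{x}\in\mathbb{R}^n:\|\boldsymbol{x}-\boldsymbol{x}_0\|_2\le\epsilon_x\}\subseteq\Delta(n).$$ Let $\kappa=\max_{\boldsymbol{x}\in\mathcal{X}}\|\boldsymbol{x}\|_2$ and $\mathcal{C}=\mathrm{cone}(\{\kappa\}\times\mathcal{X})\subset\mathbb{R}^{n+1}$. Then for every $\boldsymbol{u}\in\mathbb{R}^{n+1}$ the orthogonal projection $\pi_{\mathcal{C}}(\boldsymbol{u})$ can be computed in $O(n)$ arithmetic operations.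
   Context: $\Delta(n)$ is the probability simplex in $\mathbb{R}^n$ and $\boldsymbol{e}\in\mathbb{R}^n$ is the all-ones vector. $\mathrm{cone}(\{\kappa\}\times\mathcal{X})=\{\alpha(\kappa,\boldsymbol{x}):\alpha\ge0,\boldsymbol{x}\in\mathcal{X}\}$; $\pi_{\mathcal{C}}$ denotes the Euclidean orthogonal projection onto $\mathcal{C}$. Arithmetic operations are counted over the reals: each addition, subtraction, multiplication, division, comparison and root extraction (closed-form solution by radicals) counts as one operation. *)

(* Defs.v *)
From mathcomp Require Import all_boot all_order all_algebra.
From mathcomp Require Import all_classical all_reals.
From mathcomp Require Import complex.

Set Implicit Arguments.
Unset Strict Implicit.
Unset Printing Implicit Defensive.

Import Order.TTheory GRing.Theory Num.Theory.
Local Open Scope classical_set_scope.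
Local Open Scope ring_scope.

Section Geometry.
Variable R : realType.

Definition dotp (m : nat) (x y : 'rV[R]_m) : R := \sum_(i < m) x 0 i * y 0 i.

(* The norm of MathComp-Analysis on 'rV[R]_m is the sup norm, hence this
   separate Euclidean norm. *)
Definition norm2 (m : nat) (x : 'rV[R]_m) : R := Num.sqrt (dotp x x).

Definition ones (n : nat) : 'rV[R]_n := const_mx 1.

Definition simplex (n : nat) : set 'rV[R]_n :=
  [set x | (forall i, 0 <= x 0 i) /\ \sum_(i < n) x 0 i = 1].

Definition hyperplane1 (n : nat) : set 'rV[R]_n :=
  [set x | dotp x (ones n) = 1].

Definition cball2 (n : nat) (c : 'rV[R]_n) (eps : R) : set 'rV[R]_n :=
  [set x | norm2 (x - c) <= eps].

Definition is_max_norm2 (n : nat) (X : set 'rV[R]_n) (kappa : R) : Prop :=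
  (exists2 x, X x & norm2 x = kappa) /\ (forall x, X x -> norm2 x <= kappa).

(* R^{n+1} is identified with R x R^n, coordinate 0 being the first factor. *)
Definition cone_lift (n : nat) (kappa : R) (X : set 'rV[R]_n) :
    set 'rV[R]_(1 + n) :=
  [set y | exists (alpha : R) (x : 'rV[R]_n),
     [/\ 0 <= alpha, X x & y = alpha *: row_mx kappa%:M x]].

Definition is_orth_proj (m : nat) (C : set 'rV[R]_m) (u p : 'rV[R]_m) : Prop :=
  C p /\ forall q, C q -> norm2 (u - p) <= norm2 (u - q).

End Geometry.

Arguments simplex {R} n.
Arguments hyperplane1 {R} n.

(* Real-number programs.  A program is one finite piece of syntax, with integer
   constants only, that is run on inputs of every dimension n.  Its memory is a
   family of arrays of reals, and its loops range over 0, ..., n - 1. *)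

(* [IdxFix k] is the cell k; [IdxVar v k] is the cell i + k, where i is the
   current value of the loop counter v. *)
Inductive index : Type :=
| IdxFix of nat
| IdxVar of nat & nat.

Inductive expr : Type :=
| Cst of int
| Cell of nat & index                (* array name, cell *)
| Add of expr & expr
| Sub of expr & expr
| Mul of expr & expr
| Div of expr & expr
| RootRe of nat & expr & expr
| RootIm of nat & expr & expr.

Inductive prog : Type :=
| Skip
| Assign of nat & index & expr
| Seq of prog & prog
| IfLe of expr & expr & prog & prog  (* if e1 <= e2 then p1 else p2 *)
| For of nat & prog.                 (* loop counter, body *)

Fixpoint expr_cost (e : expr) : nat :=
  match e with
  | Cst _ | Cell _ _ => 0
  | Add e1 e2 | Sub e1 e2 | Mul e1 e2 | Div e1 e2
  | RootRe _ e1 e2 | RootIm _ e1 e2 => (expr_cost e1 + expr_cost e2).+1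
  end%N.

Section Semantics.
Variable R : realType.

Definition store := nat -> nat -> R.

Definition eval_index (rho : nat -> nat) (j : index) : nat :=
  match j with
  | IdxFix k => k
  | IdxVar v k => rho v + k
  end%N.

(* Solving by radicals requires roots of complex numbers even when the final
   solution is real (casus irreducibilis); the memory being real, the real and
   imaginary parts of the principal k-th root of a + b i are two separate
   operations.  Division by zero returns 0, as in MathComp; this adds no power
   beyond a constant factor, since programs can test for zero. *)
Fixpoint eval_expr (rho : nat -> nat) (s : store) (e : expr) : R :=
  match e with
  | Cst z => z%:~R
  | Cell a j => s a (eval_index rho j)
  | Add e1 e2 => eval_expr rho s e1 + eval_expr rho s e2
  | Sub e1 e2 => eval_expr rho s e1 - eval_expr rho s e2
  | Mul e1 e2 => eval_expr rho s e1 * eval_expr rho s e2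
  | Div e1 e2 => eval_expr rho s e1 / eval_expr rho s e2
  | RootRe k e1 e2 =>
      complex.Re (k.-root (Complex (eval_expr rho s e1) (eval_expr rho s e2)))
  | RootIm k e1 e2 =>
      complex.Im (k.-root (Complex (eval_expr rho s e1) (eval_expr rho s e2)))
  end.

Definition set_cell (s : store) (a k : nat) (r : R) : store :=
  fun b l => if (b == a) && (l == k) then r else s b l.

Definition set_counter (rho : nat -> nat) (v i : nat) : nat -> nat :=
  fun w => if w == v then i else rho w.

(* Returns the final memory and the number of operations on reals that were
   executed; copying reals and handling loop counters is not counted. *)
Fixpoint exec (n : nat) (p : prog) (rho : nat -> nat) (s : store) :
    store * nat :=
  match p with
  | Skip => (s, 0%N)
  | Assign a j e =>
      (set_cell s a (eval_index rho j) (eval_expr rho s e), expr_cost e)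
  | Seq p1 p2 =>
      let: (s1, t1) := exec n p1 rho s in
      let: (s2, t2) := exec n p2 rho s1 in
      (s2, (t1 + t2)%N)
  | IfLe e1 e2 p1 p2 =>
      let: (s', t) := if eval_expr rho s e1 <= eval_expr rho s e2
                      then exec n p1 rho s else exec n p2 rho s in
      (s', (expr_cost e1 + expr_cost e2 + 1 + t)%N)
  | For v p' =>
      foldl (fun st i =>
               let: (s', t) := exec n p' (set_counter rho v i) st.1 in
               (s', (st.2 + t)%N))
            (s, 0%N) (iota 0 n)
  end.

Definition row_cells (m : nat) (x : 'rV[R]_m) (k : nat) : R :=
  oapp (fun i : 'I_m => x 0 i) 0 (insub k).

(* Array 0 holds x0, cell 0 of array 1 holds eps, array 2 holds u; all other
   cells hold 0.  In particular kappa is not supplied. *)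
Definition input_store (n : nat) (x0 : 'rV[R]_n) (eps : R)
    (u : 'rV[R]_(1 + n)) : store :=
  fun a k =>
    match a with
    | 0%N => row_cells x0 k
    | 1%N => if k == 0%N then eps else 0
    | 2%N => row_cells u k
    | _ => 0
    end.

Definition run (p : prog) (n : nat) (x0 : 'rV[R]_n) (eps : R)
    (u : 'rV[R]_(1 + n)) : store * nat :=
  exec n p (fun=> 0%N) (input_store x0 eps u).

(* The result is read in cells 0, ..., n of array 3. *)
Definition run_output (p : prog) (n : nat) (x0 : 'rV[R]_n) (eps : R)
    (u : 'rV[R]_(1 + n)) : 'rV[R]_(1 + n) :=
  \row_(i < 1 + n) (run p x0 eps u).1 3%N i.

Definition run_cost (p : prog) (n : nat) (x0 : 'rV[R]_n) (eps : R)
    (u : 'rV[R]_(1 + n)) : nat :=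
  (run p x0 eps u).2.

End Semantics.

(* Main.v *)
(* The assumption says that X is the whole ball {x0 + d : d orthogonal to the
   all-ones vector e, |d| <= eps}, so kappa has a closed form, and the slice of
   the cone at height a is a disc of radius a * eps around a * (kappa, x0).
   Projecting onto one slice is explicit, and the squared distance from u to the
   slice is a function of a involving only the five sums n, |x0|^2, v.e, v.x0,
   |v|^2, where u = (u_0, v).  A best height exists by compactness.  As the cone
   contains the ray through the projection p, <u - p, p> = 0, and this equation
   makes the best height 0, a rational expression, or a root of a quartic.  All
   real roots of the quartic are among finitely many radical expressions
   (Ferrari, Cardano), so it suffices to compare the distances at these
   candidates. *)
Require Import Defs.
From mathcomp Require Import all_boot all_order all_algebra.
From mathcomp Require Import all_classical all_reals.
From mathcomp Require Import topology normedtype derive realfun.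
From mathcomp Require Import complex ring lra zify.

Set Implicit Arguments.
Unset Strict Implicit.
Unset Printing Implicit Defensive.

Import Order.TTheory GRing.Theory Num.Theory.
Import numFieldNormedType.Exports.
Local Open Scope classical_set_scope.
Local Open Scope ring_scope.

(** * Real roots by radicals *)

Section RealAlgebra.
Variable R : realType.
Implicit Types a b c d e m p q r x y z : R.

(** The principal square root of a negative real is purely imaginary, so its real part is the value
    0 that [Num.sqrt] takes there. *)
Lemma Re_sqrtC x : complex.Re (2.-root (Complex x 0)) = Num.sqrt x.
Proof.
case: (lerP 0 x) => [x0|x0].
  have w0 : 0 <= 2.-root (Complex x 0) by rewrite rootC_ge0 // lecE /= eqxx.
  have := rootCK (isT : (0 < 2)%N) (Complex x 0).
  case: (2.-root (Complex x 0)) w0 => a b; rewrite lecE /= => /andP[/eqP -> a0].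
  rewrite expr2 => -[<- _].
  by rewrite mulr0 subr0 -expr2 sqrtr_sqr ger0_norm.
rewrite ltr0_sqrtr //.
have := rootCK (isT : (0 < 2)%N) (Complex x 0).
case: (2.-root (Complex x 0)) => a b; rewrite expr2 => -[/= xE abE].
apply/eqP; move: abE xE; have [//|a_neq0 abE xE] := eqVneq a 0.
suff b0 : b = 0 by move: x0; rewrite -xE b0 mul0r subr0 -expr2 ltNge sqr_ge0.
by apply: (mulfI a_neq0); lra.
Qed.

Lemma cbrt_spec a b (w := 3.-root (Complex a b)) :
  let x := complex.Re w in let y := complex.Im w in
  x ^+ 3 - 3%:R * x * y ^+ 2 = a /\ 3%:R * x ^+ 2 * y - y ^+ 3 = b.
Proof.
have := rootCK (isT : (0 < 3)%N) (Complex a b); rewrite -/w.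
case: w => x y; rewrite !exprS expr0 mulr1 => -[/= <- <-].
by split; ring.
Qed.

Lemma cbrt_ge0 a : 0 <= a -> complex.Re (3.-root (Complex a 0)) ^+ 3 = a.
Proof.
move=> a0; have w0 : 0 <= 3.-root (Complex a 0) by rewrite rootC_ge0 // lecE /= eqxx.
have := cbrt_spec a 0; move: w0.
case: (3.-root _) => x y; rewrite lecE /= => /andP[/eqP -> _] [<- _].
by rewrite expr0n mulr0 subr0.
Qed.

(** The cofactor of [x - y] in [x ^+ 3 - y ^+ 3] is a positive definite form, so it vanishes only at
    [x = y = 0]. *)
Lemma expr3_inj x y : x ^+ 3 = y ^+ 3 -> x = y.
Proof.
move=> xy; apply/eqP; rewrite -subr_eq0.
have : (x - y) * ((x + y / 2%:R) ^+ 2 + 3%:R / 4%:R * y ^+ 2) = 0.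
  by have -> : 0 = x ^+ 3 - y ^+ 3 by [rewrite xy subrr]; field.
move/eqP; rewrite mulf_eq0 => /orP[//|].
have k0 : 0 < 3%:R / 4%:R :> R by lra.
rewrite paddr_eq0 ?sqr_ge0 ?(mulr_ge0 (ltW k0)) ?sqr_ge0 //.
rewrite sqrf_eq0 mulf_eq0 (gt_eqF k0) sqrf_eq0 /= => /andP[/eqP h /eqP y0].
by apply/eqP; lra.
Qed.

Lemma quadratic_root b c x (s := Num.sqrt (b ^+ 2 - 4%:R * c)) :
  x ^+ 2 + b * x + c = 0 ->
  x = (- b + s) / 2%:R \/ x = (- b - s) / 2%:R.
Proof.
move=> x0; have D : b ^+ 2 - 4%:R * c = (2%:R * x + b) ^+ 2 by lra.
rewrite /s D sqrtr_sqr; case: (ger0P (2%:R * x + b)) => h; [left|right]; lra.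
Qed.

(** Cardano's root is [s + t]. The cofactor of [y - s - t] is half a sum of three squares, whose
    vanishing forces [y = - s = - t]. *)
Lemma cubic_root_real p q s t y :
  s * t = - p / 3%:R -> s ^+ 3 + t ^+ 3 = - q ->
  y ^+ 3 + p * y + q = 0 -> y = s + t \/ y = - s.
Proof.
move=> stE stq yE.
have pE : p = - (3%:R * (s * t)) by rewrite stE; field.
have qE : q = - (s ^+ 3 + t ^+ 3) by rewrite stq opprK.
have : (y - s - t) * ((y + s) ^+ 2 + (y + t) ^+ 2 + (s - t) ^+ 2) = 0.
  by rewrite pE qE in yE; rewrite -[RHS](mulr0 2%:R) -yE; ring.
move/eqP; rewrite mulf_eq0 => /orP[/eqP h|]; first by left; lra.
rewrite paddr_eq0 ?addr_ge0 ?sqr_ge0 // paddr_eq0 ?sqr_ge0 // !sqrf_eq0.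
by move=> /andP[/andP[/eqP h _] _]; right; lra.
Qed.

(** With w = a + i b, the hypotheses say p = -3 |w|^2 and q = -2 Re(w^3); the roots are twice the
    real parts of w times the cube roots of unity. *)
Lemma cubic_root_casus a b p q y (h := Num.sqrt 3%:R * b) :
  a ^+ 2 + b ^+ 2 = - p / 3%:R -> 2%:R * (a ^+ 3 - 3%:R * a * b ^+ 2) = - q ->
  y ^+ 3 + p * y + q = 0 -> [\/ y = 2%:R * a, y = - a + h | y = - a - h].
Proof.
move=> nE wq yE.
have pE : p = - (3%:R * (a ^+ 2 + b ^+ 2)) by rewrite nE; field.
have qE : q = - (2%:R * (a ^+ 3 - 3%:R * a * b ^+ 2)) by rewrite wq opprK.
have hE : h ^+ 2 = 3%:R * b ^+ 2 by rewrite exprMn sqr_sqrtr ?ler0n.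
have : (y - 2%:R * a) * ((y + a - h) * (y + a + h)) = 0.
  have -> : (y + a - h) * (y + a + h) = (y + a) ^+ 2 - 3%:R * b ^+ 2.
    by rewrite -hE; ring.
  by rewrite pE qE in yE; rewrite -[RHS]yE; ring.
move/eqP; rewrite !mulf_eq0 => /or3P[] /eqP yh.
- by apply: Or31; lra.
- by apply: Or32; lra.
- by apply: Or33; lra.
Qed.

(** A root [m] of the resolvent turns the quartic into [(y ^+ 2 + p / 2 + m) ^+ 2 - 2 * m * (y - q /
    (4 * m)) ^+ 2], a difference of squares since [0 < m]. *)
Lemma ferrari p q r m y (s := Num.sqrt (2%:R * m)) : 0 < m ->
  m ^+ 3 + p * m ^+ 2 + (p ^+ 2 / 4%:R - r) * m - q ^+ 2 / 8%:R = 0 ->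
  y ^+ 4 + p * y ^+ 2 + q * y + r = 0 ->
  y ^+ 2 - s * y + (p / 2%:R + m + s * (q / (4%:R * m))) = 0 \/
  y ^+ 2 + s * y + (p / 2%:R + m - s * (q / (4%:R * m))) = 0.
Proof.
move=> m0 mE yE; have mn0 : m != 0 by rewrite gt_eqF.
have sE : s ^+ 2 = 2%:R * m by rewrite sqr_sqrtr ?mulr_ge0 // ltW.
have rE : r = p ^+ 2 / 4%:R + m ^+ 2 + p * m - q ^+ 2 / (8%:R * m).
  have -> : q ^+ 2 / (8%:R * m) =
            (m ^+ 3 + p * m ^+ 2 + (p ^+ 2 / 4%:R - r) * m) / m.
    by rewrite (subr0_eq mE); field.
  by field.
set k := q / (4%:R * m).
have : (y ^+ 2 - s * y + (p / 2%:R + m + s * k)) *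
       (y ^+ 2 + s * y + (p / 2%:R + m - s * k)) = 0.
  have -> : (y ^+ 2 - s * y + (p / 2%:R + m + s * k)) *
       (y ^+ 2 + s * y + (p / 2%:R + m - s * k)) =
     (y ^+ 2 + p / 2%:R + m) ^+ 2 - s ^+ 2 * (y - k) ^+ 2 by ring.
  by rewrite sE -[RHS]yE rE /k; field.
by move/eqP; rewrite mulf_eq0 => /orP[] /eqP; [left|right].
Qed.

(** The resolvent is negative at 0, because [q != 0], and nonnegative at a large [M], so the
    intermediate value theorem applies. *)
Lemma resolvent_root p q r : q != 0 -> exists2 m, 0 < m &
  m ^+ 3 + p * m ^+ 2 + (p ^+ 2 / 4%:R - r) * m - q ^+ 2 / 8%:R = 0.
Proof.
move=> q0; set c := p ^+ 2 / 4%:R - r; set d := q ^+ 2 / 8%:R.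
have d0 : 0 < d by rewrite divr_gt0 ?ltr0n // exprn_even_gt0.
pose P : {poly R} := 'X^3 + p *: 'X^2 + c *: 'X - d%:P.
have PE m : P.[m] = m ^+ 3 + p * m ^+ 2 + c * m - d by rewrite !hornerE.
(* When one factor of [M ^+ 3] is expanded, each summand of [M] dominates one lower-order term. *)
pose M := 1 + `|p| + `|c| + d.
have [p1 p2] := (ler_norm (- p), ler_norm (- c)); rewrite !normrN in p1 p2.
have M1 : 1 <= M by rewrite /M -!addrA lerDl !addr_ge0 // ltW.
have M0 : 0 <= M by lra.
have [|m /andP[m0 _] /eqP mr] := @poly_ivt _ P 0 M M0.
  rewrite !PE; apply/andP; split; first by rewrite !expr0n /=; lra.
  have MM : M <= M ^+ 2 by rewrite expr2 ler_peMr.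
  have h1 : M ^+ 3 = M ^+ 2 + `|p| * M ^+ 2 + `|c| * M ^+ 2 + d * M ^+ 2.
    by rewrite exprS {1}/M; ring.
  have h2 : 0 <= (`|p| + p) * M ^+ 2 by rewrite mulr_ge0 ?sqr_ge0 //; lra.
  have h3 : 0 <= (`|c| + c) * M by rewrite mulr_ge0 //; lra.
  have h4 : 0 <= `|c| * (M ^+ 2 - M) by rewrite mulr_ge0 //; lra.
  have h5 : 0 <= d * (M ^+ 2 - 1) by rewrite mulr_ge0 //; lra.
  by lra.
exists m; last by rewrite -PE.
rewrite lt_neqAle m0 andbT eq_sym; apply/eqP => m00.
by move: mr; rewrite PE m00 !expr0n /=; lra.
Qed.

End RealAlgebra.

(** * Expressions for the roots *)

Definition NatE (n : nat) : expr := Cst (Posz n).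
Definition OppE (e : expr) : expr := Defs.Sub (NatE 0) e.
Definition SqrtE (e : expr) : expr := RootRe 2 e (NatE 0).
Definition AbsE (e : expr) : expr := SqrtE (Mul e e).
Definition PosE (e : expr) : expr := Div (Add (AbsE e) e) (NatE 2).

(* With x / 0 = 0, the quotient d / d of d = max(0, e1 - e2) is the indicator
   of e1 > e2. *)
Definition IteLe (e1 e2 a b : expr) : expr :=
  let d := PosE (Defs.Sub e1 e2) in
  let g := Div d d in Add (Mul b g) (Mul a (Defs.Sub (NatE 1) g)).

(** The principal complex cube root of a negative real is not real; hence the root of the absolute
    value, with the sign restored by a quotient that is 0 at 0. *)
Definition CbrtE (e : expr) : expr :=
  Mul (RootRe 3 (AbsE e) (NatE 0)) (Div e (AbsE e)).

Fixpoint ExpE (e : expr) (k : nat) : expr :=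
  if k is k'.+1 then Mul e (ExpE e k') else NatE 1.


Section Evaluation.
Variables (R : realType) (rho : nat -> nat) (s : store R).
Local Notation ev := (eval_expr rho s).

Lemma ev_Nat n : ev (NatE n) = n%:R. Proof. by []. Qed.

Lemma ev_Opp e : ev (OppE e) = - ev e. Proof. exact: sub0r. Qed.

Lemma ev_Sqrt e : ev (SqrtE e) = Num.sqrt (ev e). Proof. exact: Re_sqrtC. Qed.

Lemma ev_Abs e : ev (AbsE e) = `|ev e|.
Proof. by rewrite ev_Sqrt [ev _]/= -expr2 sqrtr_sqr. Qed.

Lemma ev_Exp e k : ev (ExpE e k) = ev e ^+ k.
Proof. by elim: k => //= k; rewrite exprS => <-. Qed.

Lemma ev_Pos e : ev (PosE e) = Num.max 0 (ev e).
Proof.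
rewrite -[LHS]/((ev (AbsE e) + ev e) / 2%:R) ev_Abs.
by case: (ger0P (ev e)) => h; lra.
Qed.

Lemma ev_IteLe e1 e2 a b :
  ev (IteLe e1 e2 a b) = if ev e1 <= ev e2 then ev a else ev b.
Proof.
pose d := ev (PosE (Defs.Sub e1 e2)).
rewrite -[LHS]/(ev b * (d / d) + ev a * (1 - d / d)) /d ev_Pos /=.
case: (lerP (ev e1)) => h.
  by rewrite max_l ?subr_le0 // invr0 !mulr0 add0r subr0 mulr1.
rewrite max_r ?subr_ge0 ?(ltW h) // divff ?subr_eq0 ?gt_eqF //.
by rewrite subrr mulr0 addr0 mulr1.
Qed.

Lemma ev_Cbrt e : ev (CbrtE e) ^+ 3 = ev e.
Proof.
rewrite -[ev (CbrtE e)]/(complex.Re (3.-root (Complex (ev (AbsE e)) 0)) *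
  (ev e / ev (AbsE e))) ev_Abs exprMn cbrt_ge0 //.
have [->|e0] := eqVneq (ev e) 0; first by rewrite normr0 mul0r.
have : `|ev e| != 0 by rewrite normr_eq0.
have : `|ev e| ^+ 2 = ev e ^+ 2 by rewrite real_normK ?num_real.
move: `|ev e| => n n2 n0.
have -> : n * (ev e / n) ^+ 3 = ev e * (ev e ^+ 2 / n ^+ 2) by field.
by rewrite -n2 divff ?mulr1 // expf_neq0.
Qed.

End Evaluation.

Definition evalE := (ev_Nat, ev_Opp, ev_Sqrt, ev_Abs, ev_Exp, ev_Pos, ev_IteLe).

Opaque NatE OppE SqrtE AbsE PosE IteLe CbrtE ExpE.

Definition quadratic_exprs (b c : expr) : seq expr :=
  let s := SqrtE (Defs.Sub (ExpE b 2) (Mul (NatE 4) c)) in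
  [:: Div (Add (OppE b) s) (NatE 2); Div (Defs.Sub (OppE b) s) (NatE 2)].

(** The first two candidates serve [0 <= D], the other three [D < 0]. All are listed without testing
    [D]: spurious candidates are harmless when only the least distance is kept. *)
Definition cubic_exprs (p q : expr) : seq expr :=
  let h := Div (OppE q) (NatE 2) in
  let D := Add (ExpE h 2) (ExpE (Div p (NatE 3)) 3) in
  let s := CbrtE (Add h (SqrtE D)) in
  let t := CbrtE (Defs.Sub h (SqrtE D)) in
  let a := RootRe 3 h (SqrtE (OppE D)) in
  let b := Mul (SqrtE (NatE 3)) (RootIm 3 h (SqrtE (OppE D))) in
  [:: Add s t; OppE s; Mul (NatE 2) a; Add (OppE a) b; Defs.Sub (OppE a) b].

Definition ferrari_exprs (p q m : expr) : seq expr :=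
  let s := SqrtE (Mul (NatE 2) m) in
  let k := Mul s (Div q (Mul (NatE 4) m)) in
  let c := Add (Div p (NatE 2)) m in
  quadratic_exprs (OppE s) (Add c k) ++ quadratic_exprs s (Defs.Sub c k).

Definition biquadratic_exprs (p r : expr) : seq expr :=
  flatten [seq [:: SqrtE z; OppE (SqrtE z)] | z <- quadratic_exprs p r].

(** The substitution m = z - p / 3 removes the quadratic term of Ferrari's resolvent. *)
Definition resolvent_exprs (p q r : expr) : seq expr :=
  [seq Defs.Sub z (Div p (NatE 3)) | z <- cubic_exprs
     (OppE (Add (Div (ExpE p 2) (NatE 12)) r))
     (Defs.Sub (Defs.Sub (Div (Mul (NatE 2) (ExpE p 3)) (NatE 27))
               (Div (Mul p (Defs.Sub (Div (ExpE p 2) (NatE 4)) r)) (NatE 3)))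
          (Div (ExpE q 2) (NatE 8)))].

(** Ferrari's factorization requires a positive root of the resolvent, guaranteed only for q
    nonzero; hence the biquadratic list. Since it is not known which candidate is that root, all are
    tried. *)
Definition depressed_quartic_exprs (p q r : expr) : seq expr :=
  biquadratic_exprs p r ++
  flatten [seq ferrari_exprs p q m | m <- resolvent_exprs p q r].

Definition quartic_exprs (a b c d e : expr) : seq expr :=
  let b := Div b a in let c := Div c a in
  let d := Div d a in let e := Div e a in
  let h := Div b (NatE 4) in
  [seq Defs.Sub y h | y <- depressed_quartic_exprs
     (Defs.Sub c (Mul (NatE 6) (ExpE h 2)))
     (Add (Defs.Sub d (Mul (NatE 2) (Mul c h))) (Mul (NatE 8) (ExpE h 3)))
     (Defs.Sub (Add (Defs.Sub e (Mul d h)) (Mul c (ExpE h 2)))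
          (Mul (NatE 3) (ExpE h 4)))].

Lemma has_flatten_map (T U : Type) (P : pred T) (Q : pred U) (f : T -> seq U) l :
  (forall x, P x -> has Q (f x)) -> has P l -> has Q (flatten [seq f x | x <- l]).
Proof.
move=> fP; elim: l => //= x l IHl /orP[/fP|/IHl] h; by rewrite has_cat h ?orbT.
Qed.

Section Roots.
Variables (R : realType) (rho : nat -> nat) (s : store R).
Local Notation ev := (eval_expr rho s).
Local Notation "l ~> x" := (has (fun e => ev e == x) l) (at level 70).

Lemma quadratic_exprsP b c x :
  x ^+ 2 + ev b * x + ev c = 0 -> quadratic_exprs b c ~> x.
Proof.
by move=> /quadratic_root[] ->; rewrite /= !evalE /= !evalE eqxx ?orbT.
Qed.

Lemma cubic_exprsP p q y :
  y ^+ 3 + ev p * y + ev q = 0 -> cubic_exprs p q ~> y.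
Proof.
rewrite /cubic_exprs; set h := Div _ _; set D := Add (ExpE h 2) _ => yE.
have hE : ev h = - ev q / 2%:R by rewrite /= !evalE.
have DE : ev D = (ev q / 2%:R) ^+ 2 + (ev p / 3%:R) ^+ 3.
  by rewrite /= !evalE hE /= evalE mulNr sqrrN.
have [D0|D0] := leP 0 (ev D).
  set s1 := CbrtE _; set s2 := CbrtE _.
  have s3 : ev s1 ^+ 3 = ev h + Num.sqrt (ev D) by rewrite ev_Cbrt -ev_Sqrt.
  have t3 : ev s2 ^+ 3 = ev h - Num.sqrt (ev D) by rewrite ev_Cbrt -ev_Sqrt.
  (* Both sides have the cube h^2 - D = -(p / 3)^3, and real cubes are injective. *)
  have stE : ev s1 * ev s2 = - ev p / 3%:R.
    apply: expr3_inj; rewrite exprMn s3 t3 mulrC -subr_sqr sqr_sqrtr // DE hE.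
    by field.
  have stq : ev s1 ^+ 3 + ev s2 ^+ 3 = - ev q by rewrite s3 t3 hE; field.
  by case: (cubic_root_real stE stq yE) => -> /=; rewrite ?evalE eqxx ?orbT.
have [] := @cbrt_spec R (ev h) (Num.sqrt (- ev D)).
set z := Complex _ _; set a := complex.Re _; set b := complex.Im _ => wa wb.
(* Again by cubes: |w|^6 = |w^3|^2 = h^2 - D for the cube root w = a + i b of h + i sqrt(-D). *)
have abE : a ^+ 2 + b ^+ 2 = - ev p / 3%:R.
  apply: expr3_inj.
  have -> : (a ^+ 2 + b ^+ 2) ^+ 3 =
    (a ^+ 3 - 3%:R * a * b ^+ 2) ^+ 2 + (3%:R * a ^+ 2 * b - b ^+ 3) ^+ 2 by ring.
  by rewrite wa wb sqr_sqrtr ?oppr_ge0 ?ltW // DE hE; field.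
have wq : 2%:R * (a ^+ 3 - 3%:R * a * b ^+ 2) = - ev q by rewrite wa hE; field.
have aE : ev (RootRe 3 h (SqrtE (OppE D))) = a by rewrite /a /z -ev_Opp -ev_Sqrt.
have bE : ev (RootIm 3 h (SqrtE (OppE D))) = b by rewrite /b /z -ev_Opp -ev_Sqrt.
move: aE bE; set ea := RootRe _ _ _; set eb := RootIm _ _ _.
clearbody ea eb => aE bE.
by case: (cubic_root_casus abE wq yE) => ->;
  rewrite /= !evalE aE bE eqxx ?orbT.
Qed.

Lemma ferrari_exprsP p q r m y : 0 < ev m ->
  ev m ^+ 3 + ev p * ev m ^+ 2 + (ev p ^+ 2 / 4%:R - ev r) * ev m
    - ev q ^+ 2 / 8%:R = 0 ->
  y ^+ 4 + ev p * y ^+ 2 + ev q * y + ev r = 0 -> ferrari_exprs p q m ~> y.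
Proof.
move=> m0 mE /(ferrari m0 mE) h; rewrite has_cat; apply/orP.
case: h => h; [left|right]; apply: quadratic_exprsP; rewrite /= !evalE /= !evalE.
  by rewrite mulNr.
by [].
Qed.

Lemma biquadratic_exprsP p r y :
  y ^+ 4 + ev p * y ^+ 2 + ev r = 0 -> biquadratic_exprs p r ~> y.
Proof.
move=> yE; apply: (has_flatten_map (P := fun e => ev e == y ^+ 2)).
  move=> z /eqP zE /=; rewrite !evalE zE sqrtr_sqr.
  by case: ger0P => _; rewrite ?opprK eqxx ?orbT.
by apply: quadratic_exprsP; rewrite -exprM.
Qed.

Lemma resolvent_exprsP p q r m :
  m ^+ 3 + ev p * m ^+ 2 + (ev p ^+ 2 / 4%:R - ev r) * m - ev q ^+ 2 / 8%:R = 0 ->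
  resolvent_exprs p q r ~> m.
Proof.
move=> mE; rewrite has_map.
have : cubic_exprs
     (OppE (Add (Div (ExpE p 2) (NatE 12)) r))
     (Defs.Sub (Defs.Sub (Div (Mul (NatE 2) (ExpE p 3)) (NatE 27))
               (Div (Mul p (Defs.Sub (Div (ExpE p 2) (NatE 4)) r)) (NatE 3)))
          (Div (ExpE q 2) (NatE 8))) ~> m + ev p / 3%:R.
  by apply: cubic_exprsP; rewrite /= !evalE /= !evalE -[RHS]mE; field.
by apply: sub_has => z /eqP zE; rewrite /= !evalE zE; apply/eqP; ring.
Qed.

Lemma depressed_quartic_exprsP p q r y :
  y ^+ 4 + ev p * y ^+ 2 + ev q * y + ev r = 0 ->
  depressed_quartic_exprs p q r ~> y.
Proof.
move=> yE; rewrite has_cat; apply/orP.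
have [q0|q0] := eqVneq (ev q) 0; [left|right].
  by apply: biquadratic_exprsP; rewrite -[RHS]yE q0 mul0r addr0.
have [m m0 mE] := resolvent_root (ev p) (ev r) q0.
apply: (has_flatten_map (P := fun e => ev e == m)); last exact: resolvent_exprsP.
by move=> e /eqP eE; apply: (@ferrari_exprsP p q r); rewrite ?eE.
Qed.

Lemma quartic_exprsP a b c d e x : ev a != 0 ->
  ev a * x ^+ 4 + ev b * x ^+ 3 + ev c * x ^+ 2 + ev d * x + ev e = 0 ->
  quartic_exprs a b c d e ~> x.
Proof.
move=> a0 xE; rewrite /quartic_exprs has_map.
set h := Div (Div b a) _; set l := depressed_quartic_exprs _ _ _.
have : l ~> x + ev h.
  apply: depressed_quartic_exprsP; rewrite /= !evalE /= !evalE.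
  rewrite -[RHS](mulr0 (ev a)^-1) -xE; field.
  by rewrite a0.
by apply: sub_has => z /eqP zE; rewrite /= zE addrK.
Qed.

End Roots.

(** * Minimizing over the height *)

(** The selection is a single expression. Nesting [IteLe] duplicates subexpressions, but the list of
    candidates is fixed, so the cost does not depend on n. *)
Fixpoint argmin_expr (F : expr -> expr) (e0 : expr) (l : seq expr) : expr :=
  if l is e :: l' then
    let r := argmin_expr F e0 l' in IteLe (F e) (F r) e r
  else e0.

Lemma argmin_exprP (R : realType) (rho : nat -> nat) (s : store R)
    (F : expr -> expr) (f : R -> R) (e0 : expr) (l : seq expr)
    (a := eval_expr rho s (argmin_expr F e0 l)) :
  (forall e, eval_expr rho s (F e) = f (eval_expr rho s e)) ->
  has (fun e => eval_expr rho s e == a) (e0 :: l) /\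
  forall x, has (fun e => eval_expr rho s e == x) (e0 :: l) -> f a <= f x.
Proof.
move=> FE; rewrite /a {a}; elim: l => [|e l [IH1 IH2]].
  by rewrite /= eqxx; split=> // x; rewrite orbF => /eqP ->.
rewrite [argmin_expr _ _ _]/= ev_IteLe !FE.
set r := eval_expr rho s (argmin_expr F e0 l) in IH1 IH2 *.
case: leP => er.
  split=> [|x]; rewrite /= ?eqxx ?orbT // orbCA.
  move=> /orP[/eqP <- //|/IH2]; exact: le_trans.
split=> [|x]; rewrite /= orbCA; first by apply/orP; right.
move=> /orP[/eqP <-|/IH2//]; exact: ltW.
Qed.

Lemma exists_min_ray (R : realType) (f : R -> R) (M : R) :
  continuous f -> 0 <= M -> (forall a, M < a -> f 0 <= f a) ->
  exists2 a, 0 <= a & forall b, 0 <= b -> f a <= f b.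
Proof.
move=> cf M0 fM; have [|a] := @EVT_min R f 0 M M0.
  exact: continuous_subspaceT.
rewrite in_itv /= => /andP[a0 aM] amin; exists a => // b b0.
have [bM|Mb] := leP b M; first by apply: amin; rewrite in_itv /= b0.
by apply: le_trans (fM _ Mb); apply: amin; rewrite in_itv /= lexx.
Qed.

(** * Squared distance to a slice as a function of the height *)

Section SliceDistance.
Variables (R : realType) (N S u0 kap eps A B C : R).

(* [slice_dist a] is the squared distance from u to the slice of the cone at
   height a, where [gap a] is the norm of the component of v - a * x0 orthogonal
   to e, S = v.e, and A, B, C are the inner products |v'|^2, v'.x0', |x0'|^2 of
   the components v', x0' of v and x0 orthogonal to e. *)
Definition gap (a : R) : R := Num.sqrt (A - 2%:R * B * a + C * a ^+ 2).

Definition slice_dist (a : R) : R :=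
  (u0 - a * kap) ^+ 2 + (S - a) ^+ 2 / N + Num.max 0 (gap a - a * eps) ^+ 2.

Lemma slice_dist_continuous : continuous slice_dist.
Proof.
have cc (c : R) : continuous (fun _ : R => c) by exact: cst_continuous.
have ci : continuous (fun x : R => x) by move=> x.
have cD (f h : R -> R) : continuous f -> continuous h ->
    continuous (fun x => f x + h x).
  by move=> cf ch x; apply: cvgD; [exact: cf | exact: ch].
have cN (f : R -> R) : continuous f -> continuous (fun x => - f x).
  by move=> cf x; apply: cvgN; exact: cf.
have cM (f h : R -> R) : continuous f -> continuous h ->
    continuous (fun x => f x * h x).
  by move=> cf ch x; apply: cvgM; [exact: cf | exact: ch].
have cX (f : R -> R) : continuous f -> continuous (fun x => f x ^+ 2).
  by move=> cf; exact: cM.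
have csqrt (f : R -> R) : continuous f -> continuous (fun x => Num.sqrt (f x)).
  by move=> cf x; apply: continuous_comp; [exact: cf | exact: sqrt_continuous].
have cmax (f : R -> R) : continuous f -> continuous (fun x => Num.max 0 (f x)).
  by move=> cf x; apply: (@continuous_max R R (fun=> 0) f x); [exact: cc | exact: cf].
rewrite /slice_dist /gap.
have cMc (c : R) : continuous (fun x : R => x * c).
  exact: (cM id (fun=> c) ci (cc c)).
apply: (cD); first apply: (cD).
- by apply: (cX); apply: (cD); [exact: (cc) | apply: (cN)].
- by apply: (cM) (cc _); apply: (cX); apply: (cD); [exact: (cc) | apply: (cN)].
apply: (cX); apply: (cmax); apply: (cD); last by apply: (cN).
apply: (csqrt); apply: (cD); last by apply: (cM); [exact: (cc) | apply: (cX)].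
by apply: (cD); [exact: (cc) | apply: (cN); apply: (cM); [exact: (cc) |]].
Qed.

Lemma slice_dist_min : 0 < N ->
  exists2 a, 0 <= a & forall b, 0 <= b -> slice_dist a <= slice_dist b.
Proof.
move=> N0; set L := slice_dist 0.
have L0 : 0 <= L.
  by rewrite !addr_ge0 ?sqr_ge0 // divr_ge0 ?sqr_ge0 // ltW.
(* Past this bound [a - S] is at least [N * L + 1], so the term [(S - a) ^+ 2 / N] alone is at least
   [L]. *)
apply: (@exists_min_ray _ _ (`|S| + N * L + 1)).
- exact: slice_dist_continuous.
- by rewrite !addr_ge0 // mulr_ge0 // ltW.
move=> a Ma; rewrite -/L.
have NL : 0 <= N * L by rewrite mulr_ge0 // ltW.
have SS := ler_norm S; have S0 := normr_ge0 S.
have h : L <= (S - a) ^+ 2 / N.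
  rewrite ler_pdivlMr // mulrC.
  have h1 : N * L + 1 <= a - S by lra.
  have -> : (S - a) ^+ 2 = (a - S) ^+ 2 by ring.
  have h2 : (N * L + 1) ^+ 2 <= (a - S) ^+ 2 by rewrite ler_sqr ?nnegrE //; lra.
  apply: le_trans h2; have := sqr_ge0 (N * L); lra.
apply: le_trans h _.
rewrite /slice_dist.
have := sqr_ge0 (u0 - a * kap); have := sqr_ge0 (Num.max 0 (gap a - a * eps)); lra.
Qed.

(** Dividing the orthogonality equation by [a] and multiplying by [g] leaves [g] as the only
    radical, as a factor of one side; squaring then gives a polynomial equation of degree at most 4
    in [a]. *)
Lemma stationary_quartic (a : R) (P := kap ^+ 2 + N^-1 + C + eps ^+ 2)
    (Q := kap * u0 + S / N + B) (g := gap a) :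
  0 < N -> 0 <= A - 2%:R * B * a + C * a ^+ 2 -> 0 < a -> a * eps < g -> 0 < eps ->
  a * (kap * (u0 - a * kap) + (S - a) / N) +
    (1 - a * eps / g) * (a * (B - a * C) + a * eps / g * g ^+ 2) = 0 ->
  g * (P * a - Q) = eps * (A - 3%:R * B * a + 2%:R * C * a ^+ 2).
Proof.
move=> N0 D0 a0 ag eps0 st.
have g0 : 0 < g by apply: lt_trans ag; rewrite mulr_gt0.
have gE : A - 2%:R * B * a + C * a ^+ 2 = g ^+ 2 by rewrite sqr_sqrtr.
have -> : A - 3%:R * B * a + 2%:R * C * a ^+ 2 = g ^+ 2 - a * B + C * a ^+ 2.
  by rewrite -gE; ring.
apply/eqP; rewrite eq_sym -subr_eq0 -(mulrI_eq0 _ (mulfI (lt0r_neq0 a0))) -[X in _ == X](mulr0 g).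
rewrite -st /P /Q; apply/eqP; field.
by rewrite !gt_eqF.
Qed.

End SliceDistance.

(** * Candidates for the best height *)

Section Candidates.
Variables N S u0 kap eps A B C : expr.

Definition slice_dist_expr (a : expr) : expr :=
  let D := Add (Defs.Sub A (Mul (Mul (NatE 2) B) a)) (Mul C (ExpE a 2)) in
  Add (Add (ExpE (Defs.Sub u0 (Mul a kap)) 2) (Div (ExpE (Defs.Sub S a) 2) N))
      (ExpE (PosE (Defs.Sub (SqrtE D) (Mul a eps))) 2).

(** The first candidate serves the case where the offset already lies in the disc, the second the
    case C = 0, and the rest are the roots of the squared equation of [stationary_quartic]. *)
Definition stationary_exprs : seq expr :=
  let P := Add (Add (Add (ExpE kap 2) (Div (NatE 1) N)) C) (ExpE eps 2) in
  let Q := Add (Add (Mul kap u0) (Div S N)) B in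
  let Z := ExpE eps 2 in
  let mul3 x y z := Mul x (Mul y z) in
  [:: Div (Add (Mul kap u0) (Div S N)) (Add (ExpE kap 2) (Div (NatE 1) N)),
      Div (Add Q (Mul eps (SqrtE A))) P
    & quartic_exprs
      (Defs.Sub (Mul C (ExpE P 2)) (mul3 (NatE 4) Z (ExpE C 2)))
      (Defs.Sub (mul3 (NatE 12) Z (Mul B C))
         (Mul (NatE 2) (Add (Mul B (ExpE P 2)) (mul3 C P Q))))
      (Defs.Sub (Add (Add (Mul A (ExpE P 2)) (mul3 (NatE 4) B (Mul P Q)))
                     (Mul C (ExpE Q 2)))
         (Mul Z (Add (Mul (NatE 9) (ExpE B 2)) (mul3 (NatE 4) A C))))
      (Defs.Sub (mul3 (NatE 6) Z (Mul A B))
         (Mul (NatE 2) (Add (mul3 A P Q) (Mul B (ExpE Q 2)))))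
      (Defs.Sub (Mul A (ExpE Q 2)) (Mul Z (ExpE A 2)))].

(** Absolute values keep every candidate an admissible height and leave the nonnegative ones
    unchanged. *)
Definition height_expr : expr :=
  argmin_expr slice_dist_expr (NatE 0) [seq AbsE e | e <- stationary_exprs].

Variables (R : realType) (rho : nat -> nat) (s : store R).
Local Notation ev := (eval_expr rho s).

Lemma ev_slice_dist a : ev (slice_dist_expr a) =
  slice_dist (ev N) (ev S) (ev u0) (ev kap) (ev eps) (ev A) (ev B) (ev C) (ev a).
Proof. by rewrite /slice_dist_expr /= !evalE /= !evalE /= !evalE /= ?evalE. Qed.

Local Notation g := (gap (ev A) (ev B) (ev C)).
Local Notation sd := (slice_dist (ev N) (ev S) (ev u0) (ev kap) (ev eps)
  (ev A) (ev B) (ev C)).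

Hypotheses (N0 : 0 < ev N) (eps0 : 0 < ev eps) (C0 : 0 <= ev C).
Hypothesis B0 : ev C = 0 -> ev B = 0.
Hypothesis gap2_ge0 : forall a, 0 <= ev A - 2%:R * ev B * a + ev C * a ^+ 2.

(** This is <u - p, p> = 0 for the point p nearest to u in the slice at height [a]; [r] is the
    factor shrinking the offset into the disc. *)
Definition stationary (a : R) : Prop :=
  let r := if g a <= a * ev eps then 1 else a * ev eps / g a in
  a * (ev kap * (ev u0 - a * ev kap) + (ev S - a) / ev N) +
    (1 - r) * (a * (ev B - a * ev C) + r * g a ^+ 2) = 0.

Lemma stationary_exprsP a : 0 < a -> stationary a ->
  has (fun e => ev e == a) stationary_exprs.
Proof.
rewrite /stationary => a0; have iN0 : 0 < (ev N)^-1 by rewrite invr_gt0.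
case: leP => ga.
  rewrite subrr mul0r addr0 => /eqP; rewrite mulf_eq0 gt_eqF //= => /eqP aE.
  apply/orP; left; apply/eqP; rewrite /= !evalE.
  have k0 : 0 < ev kap ^+ 2 + 1 / ev N by rewrite div1r ltr_wpDl ?sqr_ge0.
  apply: (mulIf (lt0r_neq0 k0)); rewrite divfK ?gt_eqF //.
  by apply/eqP; rewrite -subr_eq0 -[X in _ == X]aE; apply/eqP; ring.
move=> /(stationary_quartic N0 (gap2_ge0 a) a0 ga eps0).
set P := _ + ev eps ^+ 2; set Q := _ + ev B => gE.
have P0 : ev C + ev eps ^+ 2 < P.
  by rewrite /P -addrA ltrDr ltr_wpDl ?sqr_ge0.
have PC0 : 0 < P by apply: le_lt_trans P0; rewrite addr_ge0 ?sqr_ge0.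
have PE : ev (Add (Add (Add (ExpE kap 2) (Div (NatE 1) N)) C) (ExpE eps 2)) = P.
  by rewrite /= !evalE div1r.
have QE : ev (Add (Add (Mul kap u0) (Div S N)) B) = Q by [].
rewrite /stationary_exprs; move: PE QE.
set eP := Add _ (ExpE eps 2); set eQ := Add _ B; clearbody eP eQ => PE QE.
apply/orP; right; apply/orP.
(* For C = 0 also B = 0: the quartic degenerates, but the gap is the constant sqrt(A), and
   cancelling it leaves a linear equation. *)
have [C00|Cn0] := eqVneq (ev C) 0; [left|right].
  rewrite /= evalE PE QE; apply/eqP; apply: (mulIf (lt0r_neq0 PC0)).
  rewrite divfK ?gt_eqF //.
  have := gE; rewrite /gap B0 // C00 !mulr0 !mul0r subr0 !addr0 => gE'.
  have A0 : 0 <= ev A by have := gap2_ge0 0; rewrite expr0n !mulr0 subr0 addr0.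
  have sA : 0 < Num.sqrt (ev A).
    move: ga; rewrite /gap B0 // C00 !mulr0 !mul0r subr0 addr0; apply: lt_trans.
    by rewrite mulr_gt0.
  apply: (mulfI (lt0r_neq0 sA)).
  rewrite mulrDr mulrCA -expr2 sqr_sqrtr // -gE'; ring.
apply: quartic_exprsP.
  rewrite /= !evalE PE.
  (* The leading coefficient is nonzero because P > C + eps^2 and (C + eps^2)^2 >= 4 C eps^2. *)
  have -> : ev C * P ^+ 2 - 4%:R * (ev eps ^+ 2 * ev C ^+ 2) =
    ev C * (P ^+ 2 - 4%:R * ev C * ev eps ^+ 2) by ring.
  rewrite mulf_neq0 // gt_eqF // subr_gt0.
  apply: (@le_lt_trans _ _ ((ev C + ev eps ^+ 2) ^+ 2)).
    by have := sqr_ge0 (ev C - ev eps ^+ 2); lra.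
  by rewrite ltr_sqr ?nnegrE ?addr_ge0 ?sqr_ge0 // ltW.
have /eqP := congr1 (fun x => x ^+ 2) gE.
rewrite exprMn sqr_sqrtr // -subr_eq0 => /eqP gE2.
rewrite /= !evalE /= ?evalE PE QE -[RHS]gE2; ring.
Qed.

Lemma abs_exprs_ge0 l (x : R) :
  has (fun e => ev e == x) (NatE 0 :: [seq AbsE e | e <- l]) -> 0 <= x.
Proof.
rewrite /= evalE => /orP[/eqP <- //|].
by elim: l => //= e l IHl /orP[/eqP <-|/IHl//]; rewrite ev_Abs.
Qed.

Lemma abs_exprs_has l (x : R) : 0 <= x ->
  (0 < x -> has (fun e => ev e == x) l) ->
  has (fun e => ev e == x) (NatE 0 :: [seq AbsE e | e <- l]).
Proof.
rewrite le_eqVlt => /orP[x0 _|x0 /(_ x0) h]; rewrite /= evalE ?x0 //.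
rewrite has_map orbC; apply/orP; left.
by apply: sub_has h => e /eqP eE; rewrite /= evalE eE gtr0_norm.
Qed.

(** Some minimizer exists, and being stationary it is a candidate; the best candidate does at least
    as well. *)
Lemma height_exprP (h := ev height_expr) :
  (forall a, 0 <= a -> (forall b, 0 <= b -> sd a <= sd b) -> stationary a) ->
  0 <= h /\ forall b, 0 <= b -> sd h <= sd b.
Proof.
move=> st; have [a a0 amin] := slice_dist_min (ev S) (ev u0) (ev kap) (ev eps)
  (ev A) (ev B) (ev C) N0.
have [h1 h2] := argmin_exprP (NatE 0) [seq AbsE e | e <- stationary_exprs]
  ev_slice_dist.
rewrite -/height_expr -/h in h1 h2; clearbody h; split=> [|b b0].
  exact: abs_exprs_ge0 h1.
apply: le_trans (amin b b0); apply/h2/abs_exprs_has => // a0'.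
exact: stationary_exprsP a0' (st a a0 amin).
Qed.

End Candidates.

(** * Geometry of the cone *)

Section Dot.
Variables (R : realType) (m : nat).
Implicit Types (x y z : 'rV[R]_m) (a : R).

Lemma dotpC x y : dotp x y = dotp y x.
Proof. by apply: eq_bigr => i _; rewrite mulrC. Qed.

Lemma dotpDl x y z : dotp (x + y) z = dotp x z + dotp y z.
Proof. by rewrite -big_split; apply: eq_bigr => i _; rewrite mxE mulrDl. Qed.

Lemma dotpZl a x y : dotp (a *: x) y = a * dotp x y.
Proof. by rewrite mulr_sumr; apply: eq_bigr => i _; rewrite mxE mulrA. Qed.

Lemma dotpNl x y : dotp (- x) y = - dotp x y.
Proof. by rewrite -scaleN1r dotpZl mulN1r. Qed.

Lemma dotpBl x y z : dotp (x - y) z = dotp x z - dotp y z.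
Proof. by rewrite dotpDl dotpNl. Qed.

Lemma dotpDr x y z : dotp z (x + y) = dotp z x + dotp z y.
Proof. by rewrite dotpC dotpDl !(dotpC z). Qed.

Lemma dotpZr a x y : dotp y (a *: x) = a * dotp y x.
Proof. by rewrite dotpC dotpZl dotpC. Qed.

Lemma dotpBr x y z : dotp z (x - y) = dotp z x - dotp z y.
Proof. by rewrite dotpC dotpBl !(dotpC z). Qed.

Lemma dotpNr x y : dotp y (- x) = - dotp y x.
Proof. by rewrite dotpC dotpNl dotpC. Qed.

Definition dotpE := (dotpDl, dotpDr, dotpNl, dotpNr, dotpZl, dotpZr).

Lemma dotp_ge0 x : 0 <= dotp x x.
Proof. by apply: sumr_ge0 => i _; rewrite -expr2 sqr_ge0. Qed.

Lemma dotp_eq0 x : dotp x x = 0 -> x = 0.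
Proof.
move=> /eqP; rewrite psumr_eq0 => [/allP h|i _]; last by rewrite -expr2 sqr_ge0.
apply/rowP => i; rewrite mxE; apply/eqP.
by have := h i (mem_index_enum i); rewrite mulf_eq0 orbb.
Qed.

Lemma norm2_ge0 x : 0 <= norm2 x. Proof. exact: sqrtr_ge0. Qed.

Lemma norm2_sq x : norm2 x ^+ 2 = dotp x x.
Proof. by rewrite sqr_sqrtr ?dotp_ge0. Qed.

Lemma norm2_le x y : (norm2 x <= norm2 y) = (dotp x x <= dotp y y).
Proof. by rewrite ler_sqrt // dotp_ge0. Qed.

Lemma norm2Z a x : norm2 (a *: x) = `|a| * norm2 x.
Proof. by rewrite /norm2 !dotpE mulrA -expr2 sqrtrM ?sqr_ge0 // sqrtr_sqr. Qed.

(** Cauchy-Schwarz: for nonzero vectors, expand the square of [norm2 y *: x - norm2 x *: y]. *)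
Lemma dotp_le_norm2 x y : dotp x y <= norm2 x * norm2 y.
Proof.
have [X0|Xn0] := eqVneq (norm2 x) 0.
  have := norm2_sq x; rewrite X0 expr0n => /esym/dotp_eq0 ->.
  by rewrite -(scale0r 0) dotpZl !mul0r.
have [Y0|Yn0] := eqVneq (norm2 y) 0.
  have := norm2_sq y; rewrite Y0 expr0n => /esym/dotp_eq0 ->.
  by rewrite -(scale0r 0) dotpZr mul0r mulr0.
have XY : 0 < norm2 x * norm2 y by rewrite mulr_gt0 // lt0r ?Xn0 ?Yn0 norm2_ge0.
have := dotp_ge0 (norm2 y *: x - norm2 x *: y); rewrite !dotpE -!norm2_sq.
rewrite (dotpC y x) => h.
rewrite -(ler_pM2l XY) -subr_ge0 -(pmulr_lge0 _ (ltr0Sn R 1)).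
by apply: le_trans h _; rewrite le_eqVlt; apply/orP; left; apply/eqP; ring.
Qed.

Lemma ray_orthogonal x y :
  (forall t, 0 <= t -> dotp (x - y) (x - y) <= dotp (x - t *: y) (x - t *: y)) ->
  dotp (x - y) y = 0.
Proof.
move=> h; set c := dotp (x - y) y; have [//|c0] := eqVneq c 0.
have a0 := dotp_ge0 y; have nc : 0 < `|c| by rewrite normr_gt0.
(* The test point is t = 1 + c / d. Adding |c| to |y|^2 keeps t nonnegative, and the squared
   distance changes by -(c / d)^2 (|y|^2 + 2 |c|) < 0. *)
set d := dotp y y + `|c|; have d0 : 0 < d by rewrite /d; lra.
have t0 : 0 <= 1 + c / d.
  have : - 1 <= c / d; last by lra.
  by rewrite ler_pdivlMr // mulN1r /d; have := ler_norm (- c); rewrite normrN; lra.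
have cE : c = dotp x y - dotp y y by rewrite /c !dotpE.
have {h} := h _ t0; rewrite !dotpE (dotpC y) => h.
have {h} : 0 <= - (c ^+ 2 / d ^+ 2 * (dotp y y + 2%:R * `|c|)).
  move: h; rewrite -subr_ge0 => h; apply: le_trans h _.
  rewrite le_eqVlt; apply/orP; left; apply/eqP.
  have -> : dotp y y + 2%:R * `|c| = 2%:R * d - dotp y y by rewrite /d; ring.
  have -> : dotp x y = c + dotp y y by rewrite cE subrK.
  by field; rewrite gt_eqF.
rewrite oppr_ge0 pmulr_rle0; first by lra.
by rewrite divr_gt0 ?(exprn_gt0 _ d0) // exprn_even_gt0.
Qed.

End Dot.

Lemma dotp_row_mx (R : realType) (m1 m2 : nat) (x1 y1 : 'rV[R]_m1)
    (x2 y2 : 'rV[R]_m2) :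
  dotp (row_mx x1 x2) (row_mx y1 y2) = dotp x1 y1 + dotp x2 y2.
Proof.
rewrite /dotp big_split_ord; congr (_ + _); apply: eq_bigr => i _.
  by rewrite !row_mxEl.
by rewrite !row_mxEr.
Qed.

Lemma dotp_scalar (R : realType) (a b : R) :
  dotp (a%:M : 'rV_1) (b%:M : 'rV_1) = a * b.
Proof. by rewrite /dotp big_ord1 !mxE eqxx. Qed.

Lemma dotp_ones (R : realType) n (x : 'rV[R]_n) :
  dotp x (ones R n) = \sum_(i < n) x 0 i.
Proof. by apply: eq_bigr => i _; rewrite mxE mulr1. Qed.

(** * The base of the cone and its largest norm *)

Section Geometry.
Variables (R : realType) (n : nat) (x0 : 'rV[R]_n) (eps : R).
Hypotheses (x0P : simplex n x0) (eps0 : 0 < eps).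
Hypothesis ballP : hyperplane1 n `&` cball2 x0 eps `<=` simplex n.

Local Notation e := (ones R n).
Local Notation N := (n%:R : R).
Local Notation X := (simplex n `&` cball2 x0 eps).
Local Notation C := (dotp x0 x0 - 1 / N).

Lemma dim_gt0 : (0 < n)%N.
Proof.
case: n x0 x0P => // y [_]; rewrite big_ord0 => /esym/eqP.
by rewrite oner_eq0.
Qed.

Lemma dimR_gt0 : 0 < N. Proof. by rewrite ltr0n dim_gt0. Qed.

Lemma dotp_ones_ones : dotp e e = N.
Proof.
by rewrite dotp_ones (eq_bigr (fun=> 1)) => [|i _]; rewrite ?mxE // sumr_const card_ord.
Qed.

Lemma dotp_x0_ones : dotp x0 e = 1. Proof. by rewrite dotp_ones x0P.2. Qed.

(** The inclusion hypothesis enters here: it supplies the nonnegativity of the entries. *)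
Lemma baseE x : X x <-> dotp x e = 1 /\ norm2 (x - x0) <= eps.
Proof.
split=> [[[_ x1] xe]|[x1 xe]]; first by rewrite dotp_ones.
by split=> //; apply: ballP.
Qed.

Lemma centered_sq x : dotp (x - N^-1 *: e) (x - N^-1 *: e) =
  dotp x x - 2%:R * dotp x e / N + 1 / N.
Proof.
have Nn0 := lt0r_neq0 dimR_gt0.
by rewrite !dotpE (dotpC e) dotp_ones_ones; field.
Qed.

(** [C] is the squared distance from x0 to the barycenter of the simplex. *)
Lemma C_sq : dotp (x0 - N^-1 *: e) (x0 - N^-1 *: e) = C.
Proof. by rewrite centered_sq dotp_x0_ones; field; exact: lt0r_neq0 dimR_gt0. Qed.

Lemma C_ge0 : 0 <= C. Proof. by rewrite -C_sq dotp_ge0. Qed.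

(** The direction [w] points from the barycenter to x0. If they coincide, any unit vector orthogonal
    to e works, and two distinct coordinates provide one. *)
Lemma exists_unit_direction : (1 < n)%N ->
  exists w, [/\ dotp w e = 0, dotp w w = 1 & dotp w x0 = Num.sqrt C].
Proof.
move=> n1; have [C0|Cn0] := eqVneq C 0.
  have x0E : x0 = N^-1 *: e by apply/subr0_eq/dotp_eq0; rewrite C_sq.
  have [d de dd] : exists2 d, dotp d e = 0 & dotp d d = 2%:R.
    have dotd i (y : 'rV[R]_n) : dotp (delta_mx 0 i) y = y 0 i.
      rewrite /dotp (bigD1 i) //= mxE !eqxx mul1r big1 ?addr0 // => j ji.
      by rewrite mxE eqxx (negbTE ji) mul0r.
    exists (delta_mx 0 (Ordinal (ltnW n1)) - delta_mx 0 (Ordinal n1)).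
      by rewrite dotpBl !dotd !mxE subrr.
    by rewrite dotpBl !dotd !mxE /=; ring.
  exists ((Num.sqrt 2%:R)^-1 *: d); split; first by rewrite dotpZl de mulr0.
    rewrite dotpZl dotpZr dd mulrA -invfM -expr2 sqr_sqrtr ?ler0n //.
    by rewrite mulVf ?pnatr_eq0.
  by rewrite C0 sqrtr0 x0E dotpZl dotpZr de !mulr0.
have sC : 0 < Num.sqrt C by rewrite sqrtr_gt0 lt0r Cn0 C_ge0.
have sCE : Num.sqrt C ^+ 2 = C by rewrite sqr_sqrtr ?C_ge0.
exists ((Num.sqrt C)^-1 *: (x0 - N^-1 *: e)); split.
- by rewrite dotpZl !dotpE dotp_x0_ones dotp_ones_ones mulVf ?subrr ?mulr0 ?(lt0r_neq0 dimR_gt0).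
- by rewrite dotpZl dotpZr C_sq mulrA -invfM -expr2 sCE mulVf.
apply: (mulfI (lt0r_neq0 sC)); rewrite -expr2 sCE dotpZl mulVKf ?lt0r_neq0 //.
by rewrite dotpBl dotpZl (dotpC e) dotp_x0_ones mulr1 div1r.
Qed.

(** On the hyperplane |x|^2 is 1 / N plus the squared distance to the barycenter, which is largest
    at x0 + eps w. For n = 1 the hyperplane is a point of norm 1, where moving by eps is
    impossible. *)
Lemma max_norm2E kappa : is_max_norm2 X kappa ->
  kappa = if N <= 1 then 1 else Num.sqrt (1 / N + (Num.sqrt C + eps) ^+ 2).
Proof.
case=> -[x Xx <-] xmax; have N0 := dimR_gt0; have Nn0 := lt0r_neq0 N0.
rewrite (ler_nat _ n 1); case: leqP => n1.
  have n1E : n = 1%N by apply/eqP; rewrite eqn_leq n1 dim_gt0.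
  have /baseE[x1 _] := Xx.
  rewrite /norm2; suff -> : dotp x x = 1 by rewrite sqrtr1.
  move: x1; rewrite dotp_ones /dotp; case: _ / (esym n1E) x {Xx xmax} => y.
  by rewrite !big_ord1 => ->; rewrite mulr1.
rewrite /norm2; congr Num.sqrt; apply/eqP; rewrite eq_le; apply/andP; split.
  have [d -> [de xe]] : exists2 d, x = x0 + d & dotp d e = 0 /\ norm2 d <= eps.
    have /baseE[x1 xe] := Xx; exists (x - x0); first by rewrite addrC subrK.
    by rewrite dotpBl x1 dotp_x0_ones subrr.
  have d2 : dotp d d <= eps ^+ 2.
    by rewrite -norm2_sq ler_sqr ?nnegrE ?norm2_ge0 // ltW.
  have dx : dotp d x0 <= eps * Num.sqrt C.
    have := dotp_le_norm2 d (x0 - N^-1 *: e).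
    rewrite dotpBr dotpZr de mulr0 subr0 {2}/norm2 C_sq => h.
    by apply: le_trans h _; rewrite ler_wpM2r ?sqrtr_ge0.
  have := sqr_sqrtr C_ge0; rewrite !dotpE (dotpC x0 d); lra.
have [w [we ww wx]] := exists_unit_direction n1.
have Xy : X (x0 + eps *: w).
  apply/baseE; rewrite !dotpE we dotp_x0_ones mulr0 addr0; split=> //.
  by rewrite addrC addKr norm2Z /norm2 ww sqrtr1 mulr1 gtr0_norm.
have := xmax _ Xy; rewrite norm2_le; apply: le_trans.
have := sqr_sqrtr C_ge0; rewrite !dotpE ww (dotpC x0 w) wx.
by move: (Num.sqrt C) => c cE; rewrite le_eqVlt; apply/orP; left; apply/eqP; lra.
Qed.

(** * Projection onto a slice and onto the cone *)

Variables (kappa : R) (u : 'rV[R]_(1 + n)).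

Definition tail : 'rV[R]_n := rsubmx u.
Local Notation v := tail.
Local Notation u0 := (u 0 0).
Local Notation S := (dotp v e).
Local Notation A := (dotp v v - S ^+ 2 / N).
Local Notation B := (dotp v x0 - S / N).
Local Notation g := (gap A B C).
Local Notation sd := (slice_dist N S u0 kappa eps A B C).

(** This is the component of v - a x0 orthogonal to e, as (v - a x0).e = S - a. *)
Definition offset (a : R) : 'rV[R]_n := v - a *: x0 - ((S - a) / N) *: e.

(** The factor that projects the offset radially onto the disc of radius [a * eps]. *)
Definition shrink (a : R) : R := if g a <= a * eps then 1 else a * eps / g a.

Definition nearest (a : R) : 'rV[R]_(1 + n) :=
  row_mx (a * kappa)%:M (a *: x0 + shrink a *: offset a).

Lemma u_row_mx : u = row_mx u0%:M v.
Proof.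
rewrite -[LHS]hsubmxK; congr row_mx; apply/rowP => i.
by rewrite !mxE ord1 eqxx; congr (u _ _); apply: val_inj.
Qed.

Lemma dotp_offset_ones a : dotp (offset a) e = 0.
Proof.
rewrite !dotpE dotp_x0_ones dotp_ones_ones; field; exact: lt0r_neq0 dimR_gt0.
Qed.

Lemma dotp_offset_x0 a : dotp (offset a) x0 = B - a * C.
Proof.
rewrite !dotpE (dotpC e) dotp_x0_ones; field; exact: lt0r_neq0 dimR_gt0.
Qed.

Lemma offset_sq a : dotp (offset a) (offset a) = A - 2%:R * B * a + C * a ^+ 2.
Proof.
rewrite {2}/offset dotpBr dotpZr dotp_offset_ones mulr0 subr0 dotpBr dotpZr.
rewrite dotp_offset_x0 !dotpE (dotpC x0) (dotpC e); field.
exact: lt0r_neq0 dimR_gt0.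
Qed.

Lemma gapE a : g a = norm2 (offset a).
Proof. by rewrite /gap -offset_sq. Qed.

Lemma gap_ge0 a : 0 <= g a. Proof. exact: sqrtr_ge0. Qed.

Lemma residualE a w : u - row_mx (a * kappa)%:M (a *: x0 + w) =
  row_mx (u0 - a * kappa)%:M (offset a - w + ((S - a) / N) *: e).
Proof.
rewrite [X in X - _]u_row_mx opp_row_mx add_row_mx -raddfB; congr row_mx.
by rewrite /offset [in RHS]addrAC subrK opprD addrA.
Qed.

(** The residual splits into three orthogonal parts: the first coordinate, the multiple of e, and
    the part orthogonal to e. *)
Lemma residual_sq a w : dotp w e = 0 ->
  dotp (u - row_mx (a * kappa)%:M (a *: x0 + w))
       (u - row_mx (a * kappa)%:M (a *: x0 + w)) =
  (u0 - a * kappa) ^+ 2 + (S - a) ^+ 2 / N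
    + dotp (offset a - w) (offset a - w).
Proof.
move=> we; rewrite residualE dotp_row_mx dotp_scalar -expr2 -[RHS]addrA.
congr (_ + _).
have ze : dotp (offset a - w) e = 0 by rewrite dotpBl dotp_offset_ones we subrr.
move: (offset a - w) ze => z ze.
rewrite !dotpDl !dotpDr !dotpZl !dotpZr (dotpC e z) ze dotp_ones_ones.
field; exact: lt0r_neq0 dimR_gt0.
Qed.

(** The displacement is w = a (x - x0), so each slice is a disc. *)
Lemma cone_liftP q : cone_lift kappa X q <-> exists a w,
  [/\ 0 <= a, dotp w e = 0, norm2 w <= a * eps
    & q = row_mx (a * kappa)%:M (a *: x0 + w)].
Proof.
split=> [[a [x [a0 /baseE[x1 xe] ->]]]|[a [w [a0 we wa ->]]]].
  exists a, (a *: (x - x0)); split=> //.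
  - by rewrite dotpZl dotpBl x1 dotp_x0_ones subrr mulr0.
  - by rewrite norm2Z ger0_norm // ler_wpM2l.
  by rewrite -scalerDr addrC subrK scale_row_mx scale_scalar_mx.
(* At the apex the norm bound forces w = 0, and x0 serves as base point; otherwise x = x0 + w /
   a. *)
have [az|an0] := eqVneq a 0.
  have w0 : w = 0.
    apply: dotp_eq0; rewrite -norm2_sq; apply/eqP; rewrite sqrf_eq0 eq_le.
    by rewrite norm2_ge0 andbT -(mul0r eps) -az.
  exists 0, x0; rewrite az w0 mul0r !scale0r addr0; split=> //.
    by apply/baseE; rewrite subrr -(scale0r 0) norm2Z normr0 mul0r ltW ?dotp_x0_ones.
  by rewrite raddf0 row_mx0.
have ap : 0 < a by rewrite lt0r an0.
exists a, (x0 + a^-1 *: w); split=> //.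
  apply/baseE; rewrite dotpDl dotpZl we mulr0 addr0; split; first exact: dotp_x0_ones.
  by rewrite addrC addKr norm2Z gtr0_norm ?invr_gt0 // mulrC ler_pdivrMr // mulrC.
by rewrite scale_row_mx scale_scalar_mx scalerDr scalerA divff // scale1r.
Qed.

(** The reverse triangle inequality, squared where the gap exceeds the radius. *)
Lemma offset_dist_ge a w : norm2 w <= a * eps ->
  Num.max 0 (g a - a * eps) ^+ 2 <= dotp (offset a - w) (offset a - w).
Proof.
move=> wa; have [ga|ga] := leP (g a - a * eps) 0; first by rewrite expr0n dotp_ge0.
apply: (@le_trans _ _ ((g a - norm2 w) ^+ 2)).
  by rewrite ler_sqr ?nnegrE ?(ltW ga) //; lra.
have := dotp_le_norm2 (offset a) w; rewrite gapE; move: (offset a) => z.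
rewrite dotpBl !dotpBr (dotpC w) -!norm2_sq; lra.
Qed.

Lemma shrink_bounds a : 0 <= a -> shrink a * g a <= a * eps /\
  Num.max 0 (g a - a * eps) = (1 - shrink a) * g a.
Proof.
move=> a0; rewrite /shrink; case: ifPn => [ga|]; last rewrite -ltNge => ga.
  by rewrite subrr mul0r (mul1r (g a)); split=> //; rewrite max_l // subr_le0.
have g0 : g a != 0 by rewrite gt_eqF // (le_lt_trans _ ga) // mulr_ge0 // ltW.
by rewrite mulrBl (mul1r (g a)) divfK //; split=> //; rewrite max_r // subr_ge0 ltW.
Qed.

Lemma shrink_ge0 a : 0 <= a -> 0 <= shrink a.
Proof.
move=> a0; rewrite /shrink; case: ifP => // _.
by rewrite divr_ge0 ?gap_ge0 // mulr_ge0 // ltW.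
Qed.

Lemma nearest_in_cone a : 0 <= a -> cone_lift kappa X (nearest a).
Proof.
move=> a0; apply/cone_liftP; exists a, (shrink a *: offset a); split=> //.
  by rewrite dotpZl dotp_offset_ones mulr0.
by rewrite norm2Z ger0_norm ?shrink_ge0 // -gapE; case: (shrink_bounds a0).
Qed.

Lemma nearest_dist a : 0 <= a ->
  dotp (u - nearest a) (u - nearest a) = sd a.
Proof.
move=> a0; rewrite residual_sq; last by rewrite dotpZl dotp_offset_ones mulr0.
congr (_ + _); rewrite (shrink_bounds a0).2 gapE.
have -> : offset a - shrink a *: offset a = (1 - shrink a) *: offset a.
  by rewrite scalerBl scale1r.
by rewrite dotpZl dotpZr exprMn norm2_sq mulrA -expr2.
Qed.

Lemma cone_dist_ge q : cone_lift kappa X q ->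
  exists2 b, 0 <= b & sd b <= dotp (u - q) (u - q).
Proof.
move=> /cone_liftP[b [w [b0 we wb ->]]]; exists b => //.
by rewrite residual_sq // lerD2l offset_dist_ge.
Qed.

Lemma nearest_is_orth_proj a : 0 <= a -> (forall b, 0 <= b -> sd a <= sd b) ->
  is_orth_proj (cone_lift kappa X) u (nearest a).
Proof.
move=> a0 amin; split; first exact: nearest_in_cone.
move=> q /cone_dist_ge[b b0 bq].
by rewrite norm2_le nearest_dist // (le_trans (amin b b0)).
Qed.

(** Multiples of [nearest a] lie in other slices of the cone, hence are no closer to u.
    Orthogonality to the ray replaces differentiating [slice_dist] through its square root and
    maximum. *)
Lemma nearest_stationary a : 0 <= a -> (forall b, 0 <= b -> sd a <= sd b) ->
  a * (kappa * (u0 - a * kappa) + (S - a) / N) +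
    (1 - shrink a) * (a * (B - a * C) + shrink a * g a ^+ 2) = 0.
Proof.
move=> a0 amin; have : dotp (u - nearest a) (nearest a) = 0.
  apply: ray_orthogonal => t t0; rewrite nearest_dist //.
  have /cone_dist_ge[b b0] : cone_lift kappa X (t *: nearest a).
    have [c [x [c0 Xx ->]]] := nearest_in_cone a0.
    by exists (t * c), x; rewrite scalerA; split=> //; rewrite mulr_ge0.
  exact/le_trans/amin.
move=> <-; rewrite residualE dotp_row_mx dotp_scalar; set r := shrink a.
rewrite -{1}(scale1r (offset a)) -scalerBl.
rewrite dotpDl !dotpZl !dotpDr !dotpZr (dotpC e (offset a)) (dotpC e x0).
by rewrite dotp_offset_ones dotp_offset_x0 dotp_x0_ones gapE norm2_sq; ring.
Qed.

End Geometry.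

(** * The program *)

Section Execution.
Variable R : realType.
Implicit Types (rho : nat -> nat) (s : store R) (e : expr) (F : nat -> R).

Lemma exec_Seq n p1 p2 rho s s1 s2 t1 t2 :
  exec n p1 rho s = (s1, t1) -> exec n p2 rho s1 = (s2, t2) ->
  exec n (Seq p1 p2) rho s = (s2, (t1 + t2)%N).
Proof. by move=> /= -> ->. Qed.

(** The store [s'] is arbitrary at the accumulator, which holds a partial sum: the value of [e] must
    not depend on it. *)
Lemma exec_sum n v b k e rho s F :
  (forall i s', (forall c l, (c, l) != (b, k) -> s' c l = s c l) ->
    eval_expr (set_counter rho v i) s' e = F i) ->
  exec n (For v (Assign b (IdxFix k) (Add (Cell b (IdxFix k)) e))) rho s =
  (set_cell s b k (s b k + \sum_(i < n) F i), (n * (expr_cost e).+1)%N).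
Proof.
move=> eF; rewrite [LHS]/=; set step := fun _ => _.
(* The number of iterations is separated from the dimension [n], which stays fixed inside [step]. *)
suff H m : foldl step (s, 0%N) (iota 0 m) =
    (set_cell s b k (s b k + \sum_(i < m) F i), (m * (expr_cost e).+1)%N) by exact: H.
elim: m => [|m IHm].
  rewrite big_ord0 addr0 /=; congr pair; apply/funext => c; apply/funext => l.
  by rewrite /set_cell; case: ifP => // /andP[/eqP -> /eqP ->].
rewrite -addn1 iotaD foldl_cat IHm add0n /= /step /= mulnDl mul1n add0n; congr pair.
rewrite (eF m) => [|c l]; last first.
  by rewrite /set_cell xpair_eqE; case: ifP.
apply/funext => c; apply/funext => l; rewrite /set_cell !eqxx /=.
by case: ifP => [_|-> //]; rewrite addn1 big_ord_recr addrA.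
Qed.

Lemma exec_map n v b k e rho s F :
  (forall i s', (forall c l, c != b -> s' c l = s c l) ->
    eval_expr (set_counter rho v i) s' e = F i) ->
  exec n (For v (Assign b (IdxVar v k) e)) rho s =
  (fun c l => if (c == b) && (k <= l < n + k)%N then F (l - k)%N else s c l,
   (n * expr_cost e)%N).
Proof.
move=> eF; rewrite [LHS]/=; set step := fun _ => _.
suff H m : foldl step (s, 0%N) (iota 0 m) =
    (fun c l => if (c == b) && (k <= l < m + k)%N then F (l - k)%N else s c l,
     (m * expr_cost e)%N) by exact: H.
elim: m => [|m IHm].
  rewrite /=; congr pair; apply/funext => c; apply/funext => l.
  by rewrite add0n; case: (leqP k l); rewrite ?andbF.
rewrite -addn1 iotaD foldl_cat IHm add0n /= /step /= mulnDl mul1n; congr pair.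
rewrite (eF m) => [|c l cb]; last by rewrite (negbTE cb).
apply/funext => c; apply/funext => l; rewrite /set_cell /set_counter eqxx.
case: (c =P b) => //= _; rewrite addn1 addSn ltnS.
have [->|lm] := eqVneq l (m + k)%N; first by rewrite leq_addl leqnn addnK.
by rewrite [(l <= m + k)%N]leq_eqVlt (negbTE lm).
Qed.

End Execution.

(* Cells 0 to 4 of array 4 hold n, |x0|^2, v.e, v.x0 and |v|^2; cells 5, 6 and 7
   hold kappa, the height and the shrinking factor of the projection. *)
Definition cell (k : nat) : expr := Cell 4 (IdxFix k).
Definition x0_entry : expr := Cell 0 (IdxVar 0 0).
(** The shift by 1 skips the coordinate u_0 stored in cell 0. *)
Definition u_entry : expr := Cell 2 (IdxVar 0 1).

Definition sum_prog (k : nat) (e : expr) : prog :=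
  For 0 (Assign 4 (IdxFix k) (Add (cell k) e)).

Definition output_entry : expr :=
  let ax := Mul (cell 6) x0_entry in
  Add ax (Mul (cell 7) (Defs.Sub (Defs.Sub u_entry ax)
                          (Div (Defs.Sub (cell 2) (cell 6)) (cell 0)))).

(** The dimension is not supplied in memory, so the first loop counts it by adding ones. The three
    scalar expressions are evaluated once, outside the loops. *)
Definition cone_prog (kap_e height_e shrink_e : expr) : prog :=
  Seq (sum_prog 0 (NatE 1)) (
  Seq (sum_prog 1 (Mul x0_entry x0_entry)) (
  Seq (sum_prog 2 u_entry) (
  Seq (sum_prog 3 (Mul u_entry x0_entry)) (
  Seq (sum_prog 4 (Mul u_entry u_entry)) (
  Seq (Assign 4 (IdxFix 5) kap_e) (
  Seq (Assign 4 (IdxFix 6) height_e) (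
  Seq (Assign 4 (IdxFix 7) shrink_e) (
  Seq (Assign 3 (IdxFix 0) (Mul (cell 6) (cell 5)))
    (For 0 (Assign 3 (IdxVar 0 1) output_entry)))))))))).

Section ConeProg.
Variables (R : realType) (n : nat) (x0 : 'rV[R]_n) (eps : R) (u : 'rV[R]_(1 + n)).
Variables kap_e height_e shrink_e : expr.

Lemma row_cells_ord m (x : 'rV[R]_m) (i : 'I_m) : row_cells x i = x 0 i.
Proof. by rewrite /row_cells valK. Qed.

Lemma row_cells_tail (i : 'I_n) : row_cells u (i + 1) = tail u 0 i.
Proof. by rewrite (addnC (i : nat) 1%N) mxE; exact: (row_cells_ord u (rshift 1 i)). Qed.

Definition sums_store : store R :=
  let s := input_store x0 eps u in
  let s := set_cell s 4 0 n%:R in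
  let s := set_cell s 4 1 (dotp x0 x0) in
  let s := set_cell s 4 2 (dotp (tail u) (ones R n)) in
  let s := set_cell s 4 3 (dotp (tail u) x0) in
  set_cell s 4 4 (dotp (tail u) (tail u)).

Local Notation rho0 := (fun=> 0%N).
Let kap := eval_expr rho0 sums_store kap_e.
Let s6 := set_cell sums_store 4 5 kap.
Let h := eval_expr rho0 s6 height_e.
Let s7 := set_cell s6 4 6 h.
Let r := eval_expr rho0 s7 shrink_e.
Local Notation out i := (h * row_cells x0 i + r * (row_cells u (i + 1) -
  h * row_cells x0 i - (dotp (tail u) (ones R n) - h) / n%:R)).

Lemma run_cone_prog :
  run (cone_prog kap_e height_e shrink_e) x0 eps u =
  (fun c l => if (c == 3) && (1 <= l < n + 1)%N then out (l - 1)%N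
     else set_cell (set_cell s7 4 7 r) 3 0 (h * kap) c l,
   n * 1 + (n * 2 + (n * 1 + (n * 2 + (n * 2 + (expr_cost kap_e +
     (expr_cost height_e + (expr_cost shrink_e + (1 + n * 8)))))))))%N.
Proof.
rewrite /run /cone_prog.
(* Array 4 is initially zero, so the accumulators require no initialization. *)
have sum_store k e (s : store R) F x : s 4 k = 0 ->
    (forall i s', (forall c l, (c, l) != (4, k) -> s' c l = s c l) ->
      eval_expr (set_counter rho0 0 i) s' e = F i) ->
    \sum_(i < n) F i = x ->
    exec n (sum_prog k e) rho0 s = (set_cell s 4 k x, (n * (expr_cost e).+1)%N).
  by move=> s0 eF <-; rewrite /sum_prog (@exec_sum _ _ _ _ _ _ _ _ F) // s0 add0r.
apply: exec_Seq.
  apply: (sum_store _ _ _ (fun=> 1) n%:R) => //.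
  by rewrite sumr_const card_ord.
apply: exec_Seq.
  apply: (sum_store _ _ _ (fun i => row_cells x0 i * row_cells x0 i) (dotp x0 x0)) => //.
    by move=> i s' E; rewrite /= !E //= addn0.
  by rewrite /dotp; apply: eq_bigr => i _; rewrite row_cells_ord.
apply: exec_Seq.
  apply: (sum_store _ _ _ (fun i => row_cells u (i + 1)) (dotp (tail u) (ones R n))) => //.
    by move=> i s' E; rewrite /= !E.
  by rewrite /dotp; apply: eq_bigr => i _; rewrite row_cells_tail [ones R n 0 i]mxE mulr1.
apply: exec_Seq.
  apply: (sum_store _ _ _ (fun i => row_cells u (i + 1) * row_cells x0 i)
    (dotp (tail u) x0)) => //.
    by move=> i s' E; rewrite /= !E //= addn0.
  by rewrite /dotp; apply: eq_bigr => i _; rewrite row_cells_tail row_cells_ord.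
apply: exec_Seq.
  apply: (sum_store _ _ _ (fun i => row_cells u (i + 1) * row_cells u (i + 1))
    (dotp (tail u) (tail u))) => //.
    by move=> i s' E; rewrite /= !E.
  by rewrite /dotp; apply: eq_bigr => i _; rewrite row_cells_tail.
do 4 (apply: exec_Seq; first exact: erefl).
rewrite (@exec_map R n 0 3 1 output_entry _ _ (fun i => out i)) => [//|i s' E].
by rewrite /= !E //= addn0.
Qed.

Lemma run_cone_prog_output :
  run_output (cone_prog kap_e height_e shrink_e) x0 eps u =
  row_mx (h * kap)%:M (h *: x0 + r *: offset x0 u h).
Proof.
apply/rowP => i; rewrite mxE run_cone_prog.
case: (splitP i) => j ij.
  have -> : i = lshift n j by exact: val_inj.
  by rewrite row_mxEl [j]ord1 mxE.
have -> : i = rshift 1 j by exact: val_inj.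
rewrite row_mxEr /= (addnC n 1%N) ltn_add2l ltn_ord addKn.
by rewrite row_cells_ord row_cells_tail !mxE mulr1.
Qed.

End ConeProg.

(** * Scalar formulas of the program and correctness of the whole *)

Definition eps_expr : expr := Cell 1 (IdxFix 0).
Definition u0_expr : expr := Cell 2 (IdxFix 0).
Definition A_expr : expr := Defs.Sub (cell 4) (Div (ExpE (cell 2) 2) (cell 0)).
Definition B_expr : expr := Defs.Sub (cell 3) (Div (cell 2) (cell 0)).
Definition C_expr : expr := Defs.Sub (cell 1) (Div (NatE 1) (cell 0)).

Definition kappa_expr : expr :=
  IteLe (cell 0) (NatE 1) (NatE 1)
    (SqrtE (Add (Div (NatE 1) (cell 0)) (ExpE (Add (SqrtE C_expr) eps_expr) 2))).

Definition cone_height_expr : expr :=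
  height_expr (cell 0) (cell 2) u0_expr (cell 5) eps_expr A_expr B_expr C_expr.

Definition shrink_expr : expr :=
  let w := Mul (cell 6) eps_expr in
  let g := SqrtE (Add (Defs.Sub A_expr (Mul (Mul (NatE 2) B_expr) (cell 6)))
                      (Mul C_expr (ExpE (cell 6) 2))) in
  IteLe g w (NatE 1) (Div w g).

Theorem proposition4p6 (R : realType) :
  exists (p : prog) (K : nat),
    forall (n : nat) (x0 : 'rV[R]_n) (eps_x : R),
      simplex n x0 ->
      0 < eps_x ->
      hyperplane1 n `&` cball2 x0 eps_x `<=` simplex n ->
      let X := simplex n `&` cball2 x0 eps_x in
      forall kappa : R, is_max_norm2 X kappa ->
      forall u : 'rV[R]_(1 + n),
        is_orth_proj (cone_lift kappa X) u (run_output p x0 eps_x u) /\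
        (run_cost p x0 eps_x u <= K * n)%N.
Proof.
exists (cone_prog kappa_expr cone_height_expr shrink_expr).
(* The six loops cost 1 + 2 + 1 + 2 + 2 + 8 = 16 per index; the last 1 is the product giving the
   first output coordinate. The constant part is absorbed because n is at least 1. *)
exists (16 + (expr_cost kappa_expr +
  (expr_cost cone_height_expr + (expr_cost shrink_expr + 1))))%N.
move=> n x0 eps x0P eps0 ballP X kappa kappaP u; split; last first.
  have n0 := dim_gt0 x0P; rewrite /run_cost run_cone_prog /snd.
  move: (expr_cost kappa_expr) (expr_cost cone_height_expr) => a b.
  move: (expr_cost shrink_expr) => c.
  have : (a + (b + (c + 1)) <= (a + (b + (c + 1))) * n)%N by rewrite leq_pmulr.
  lia.
rewrite run_cone_prog_output.
(* The closed form identifies the computed value with [kappa], which the program does not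
   receive. *)
have kE : eval_expr (fun=> 0%N) (sums_store x0 eps u) kappa_expr = kappa.
  rewrite (max_norm2E x0P eps0 ballP kappaP) ev_IteLe.
  by do 4 rewrite /= ?evalE.
rewrite kE; set s6 := set_cell (sums_store x0 eps u) 4 5 kappa.
have Eu0 : eval_expr (fun=> 0%N) s6 u0_expr = u 0 0 by exact: (row_cells_ord u 0).
have EA : eval_expr (fun=> 0%N) s6 A_expr =
  dotp (tail u) (tail u) - dotp (tail u) (ones R n) ^+ 2 / n%:R by rewrite /= !evalE.
have EB : eval_expr (fun=> 0%N) s6 B_expr =
  dotp (tail u) x0 - dotp (tail u) (ones R n) / n%:R by [].
have EC : eval_expr (fun=> 0%N) s6 C_expr = dotp x0 x0 - 1 / n%:R by rewrite /= !evalE.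
have := @height_exprP (cell 0) (cell 2) u0_expr (cell 5) eps_expr
    A_expr B_expr C_expr R (fun=> 0%N) s6.
rewrite -/cone_height_expr /stationary Eu0 EA EB EC.
set h := eval_expr _ s6 cone_height_expr; set s7 := set_cell s6 4 6 h.
have -> : eval_expr (fun=> 0%N) s7 shrink_expr = shrink x0 eps u h.
  rewrite ev_IteLe.
  by do 4 rewrite /= ?evalE.
case.
- exact: dimR_gt0 x0P.
- exact: eps0.
- exact: C_ge0 x0P.
(* C = 0 puts x0 at the barycenter, whence v.x0 = S / N and B = 0. *)
- rewrite -(C_sq x0P) => /dotp_eq0/subr0_eq ->.
  by rewrite dotpZr mulrC subrr.
- by move=> a; rewrite -(offset_sq x0P) dotp_ge0.
- by move=> a a0 amin; apply: (nearest_stationary x0P eps0 ballP).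
by move=> h0 hmin; apply: nearest_is_orth_proj.
Qed.
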